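(* Let $G=(V,E)$ be a hypergraph and let $(V_1,\dots,V_k)$ be a maximal minimum $k$-partition in $G$ for an integer $k\ge 2$. Suppose $|V_1|\ge 2k-2$. Then for every subset $T\subseteq V\setminus V_1$ such that $T\cap V_j\neq\emptyset$ for every $j\in\{2,\dots,k\}$, there exists a subset $S\subseteq V_1$ with $|S|=2k-2$ such that $(V_1,V\setminus V_1)$ is the source maximal minimum $(S,T)$-terminal cut.
   Context: A hypergraph $G=(V,E)$ has a finite vertex set $V$ and a finite multiset $E$ of hyperedges (subsets of $V$); all hyperedges have unit cost. For $U\subseteq V$, $\overline{U}=V\setminus U$, and $d(U)$ is the number of hyperedges intersecting both $U$ and $\overline{U}$. For a partition $(P_1,\dots,P_h)$ of $V$ into non-empty sets (ordered tuple), $\mathrm{cost}(P_1,\dots,P_h)$ is the number of hyperedges intersecting at least two parts. A minimum $k$-partition is a $k$-partition of minimum cost. A minimum $k$-partition $(V_1,\dots,V_k)$ is a maximal minimum $k$-partition if there is no other minimum $k$-partition $(V_1',\dots,V_k')$ with $V_1\subsetneq V_1'$. For disjoint $S,T\subseteq V$, a 2-partition $(U,\overline{U})$ is an $(S,T)$-terminal cut if $S\subseteq U\subseteq V\setminus T$; it is a minimum $(S,T)$-terminal cut if $d(U)$ is minimum among all $(S,T)$-terminal cuts; the source maximal minimum $(S,T)$-terminal cut is the (unique) minimum $(S,T)$-terminal cut whose source set $U$ is inclusion-wise maximal. *)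

(* Defs.v *)
From mathcomp Require Import all_boot.
Set Implicit Arguments. Unset Strict Implicit. Unset Printing Implicit Defensive.

(* A hypergraph on a finite vertex type V is a multiset (seq) of hyperedges
   E : seq {set V}; all hyperedges have unit cost. *)
Section Hyper.
Variable V : finType.
Variable E : seq {set V}.

Definition dcut (U : {set V}) : nat :=
  count (fun e => (e :&: U != set0) && (e :&: ~: U != set0)) E.

Definition is_partition (P : seq {set V}) : Prop :=
  [/\ all (fun A => A != set0) P,
      (forall i j, i < j -> j < size P ->
         [disjoint nth set0 P i & nth set0 P j])
    & \bigcup_(A <- P) A = [set: V]].

Definition is_kpartition (k : nat) (P : seq {set V}) : Prop :=
  size P = k /\ is_partition P.

Definition pcost (P : seq {set V}) : nat :=
  count (fun e => 1 < count (fun A => e :&: A != set0) P) E.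

Definition is_min_kpartition (k : nat) (P : seq {set V}) : Prop :=
  is_kpartition k P /\
  (forall Q, is_kpartition k Q -> pcost P <= pcost Q).

(* V_1 is the first part, nth set0 P 0 *)
Definition is_maximal_min_kpartition (k : nat) (P : seq {set V}) : Prop :=
  is_min_kpartition k P /\
  ~ (exists Q, is_min_kpartition k Q /\ nth set0 P 0 \proper nth set0 Q 0).

(* (U, ~U) is an (S,T)-terminal cut *)
Definition is_terminal_cut (S T U : {set V}) : Prop :=
  S \subset U /\ U \subset ~: T.

Definition is_min_terminal_cut (S T U : {set V}) : Prop :=
  is_terminal_cut S T U /\
  (forall U', is_terminal_cut S T U' -> dcut U <= dcut U').

Definition is_source_maximal_min_terminal_cut (S T U : {set V}) : Prop :=
  is_min_terminal_cut S T U /\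
  ~ (exists U', is_min_terminal_cut S T U' /\ U \proper U').

End Hyper.

(* Main.v *)
Require Import Defs.
From mathcomp Require Import all_boot.
From mathcomp Require Import zify.

Set Implicit Arguments.
Unset Strict Implicit.
Unset Printing Implicit Defensive.

(** Uncrossing [V_1] with a cheaper terminal cut [X] shows that [V_1] is the
source maximal minimum [(V_1,T)]-cut.  Shrink the source set from [V_1] one
vertex at a time, keeping this property.  If the process is stuck at [S], then
every [u] in [S] has a set [A_u] containing [u] and the complement of [V_1], no
other element of [S], and with [d(A_u) < d(V_1)].  Let [Y_u] be the set of
points lying in [A_u] and in no other [A_v].  Adding the [A_u] one by one and
uncrossing each with the union of the previous ones and with the set of points
covered twice so far produces [|S| - 2] sets that avoid [S] and contain the
complement of [V_1], hence have cut value at least [d(V_1)].  What is left of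
[sum_u d(A_u)] is less than [2 d(V_1)], and it pays for two [k]-partitions, each
made of [k - 1] of the [Y_u] and a remainder, on disjoint sets of indices.  This
is possible once [|S| >= 2 (k - 1)], and one of the two then costs less than
[d(V_1)], which is at most the cost of the given partition. *)

Section Uncrossing.
Variable V : finType.
Implicit Types (e A B U X R S T : {set V}) (s P : seq {set V}) (E : seq {set V}).

(** * Cuts and partition costs, one hyperedge at a time *)

Definition crosses e U : bool := (e :&: U != set0) && (e :&: ~: U != set0).

Definition splits e P : bool := 1 < count (fun A => e :&: A != set0) P.

Lemma dcutE E U : dcut E U = \sum_(e <- E) crosses e U.
Proof. by rewrite /dcut -sumn_count sumnE big_map. Qed.

Lemma pcostE E P : pcost E P = \sum_(e <- E) splits e P.
Proof. by rewrite /pcost -sumn_count sumnE big_map. Qed.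

Lemma dcutC E U : dcut E (~: U) = dcut E U.
Proof. by apply: eq_count => e; rewrite setCK andbC. Qed.

Lemma meetU e A B :
  (e :&: (A :|: B) != set0) = (e :&: A != set0) || (e :&: B != set0).
Proof. by rewrite setIUr setU_eq0 negb_and. Qed.

Lemma meetP e U : reflect (exists2 x, x \in e & x \in U) (e :&: U != set0).
Proof.
apply: (iffP (set0Pn _)) => [[x /setIP[xe xU]]|[x xe xU]]; exists x => //.
by rewrite inE xe.
Qed.

Lemma meetS e A B : A \subset B -> e :&: A != set0 -> e :&: B != set0.
Proof. by move=> /subsetP AB /meetP[x xe /AB xB]; apply/meetP; exists x. Qed.

Lemma crosses_submod e A B :
  crosses e (A :&: B) + crosses e (A :|: B) <= crosses e A + crosses e B.
Proof.
rewrite /crosses setCI setCU !meetU.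
have := @meetS e _ _ (subsetIl A B); have := @meetS e _ _ (subsetIr A B).
have := @meetS e _ _ (subsetIl (~: A) (~: B)).
have := @meetS e _ _ (subsetIr (~: A) (~: B)).
move=> /implyP + /implyP + /implyP + /implyP.
by do 6!case: (_ != _).
Qed.

Lemma dcut_submod E A B :
  dcut E (A :&: B) + dcut E (A :|: B) <= dcut E A + dcut E B.
Proof.
rewrite !dcutE -!big_split /=; apply: leq_sum => e _; exact: crosses_submod.
Qed.

Lemma count_gt1 (I : eqType) (a : pred I) (r : seq I) u v :
  u != v -> u \in r -> v \in r -> a u -> a v -> 1 < count a r.
Proof.
move=> uv ur vr au av; rewrite -size_filter.
apply: (@uniq_leq_size _ [:: u; v]) => [|w]; first by rewrite /= inE uv.
by rewrite !inE mem_filter => /orP[] /eqP ->; apply/andP.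
Qed.

Lemma count_le1 (I : eqType) (a : pred I) (r : seq I) u :
  uniq r -> (forall v, v \in r -> a v -> v = u) -> count a r <= 1.
Proof.
move=> ur au; rewrite -size_filter.
apply: (@uniq_leq_size _ _ [:: u]) => [|w]; first exact: filter_uniq.
by rewrite mem_filter inE => /andP[aw wr]; rewrite (au w).
Qed.

(** * Uncrossing a family of sets, entry by entry *)

Definition covered s : {set V} := [set x | has (fun A => x \in A) s].

Definition overlap s : {set V} := [set x | 1 < count (fun A => x \in A) s].

(** The summands are the intersections left over when entries are added from the tail and uncrossed;
    the last two entries only give [f set0]. *)
Fixpoint overlap_sum (f : {set V} -> nat) s : nat :=
  if s is A :: s' then f (overlap s' :&: A) + overlap_sum f s' else 0.

Lemma overlap_sum_dcut E s :
  overlap_sum (dcut E) s = \sum_(e <- E) overlap_sum (crosses e) s.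
Proof.
elim: s => [|A s IHs] /=; first by rewrite big1.
by rewrite IHs dcutE -big_split.
Qed.

(** Adding [A] uses submodularity twice: on [covered s] and [A], then on [overlap s] and the
    resulting [covered s :&: A]. The second pair yields the new overlap and, as [overlap s] lies in
    [covered s], the new summand. *)
Lemma overlap_sum_crosses e s :
  crosses e (overlap s) + crosses e (covered s) + overlap_sum (crosses e) s
    <= \sum_(A <- s) crosses e A.
Proof.
elim: s => [|A s IHs] /=.
  have -> : overlap [::] = set0 by apply/setP=> x; rewrite !inE.
  have -> : covered [::] = set0 by apply/setP=> x; rewrite !inE.
  by rewrite big_nil /crosses setI0 eqxx.
rewrite big_cons.
have covE : covered (A :: s) = covered s :|: A.
  by apply/setP=> x; rewrite !inE orbC.
have ovE : overlap (A :: s) = overlap s :|: (covered s :&: A).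
  by apply/setP=> x; rewrite !inE /= has_count; case: (x \in A) => /=; lia.
have ovA : overlap s :&: (covered s :&: A) = overlap s :&: A.
  apply/setP=> x; rewrite !inE has_count; case: (x \in A) => /=; lia.
have := crosses_submod e (covered s) A.
have := crosses_submod e (overlap s) (covered s :&: A).
by rewrite ovA -ovE -covE; lia.
Qed.

(** A summand counts [e] only if [A] meets [e] and some vertex of [e] lies in two later entries.
    Hence the first two entries met, counted from the tail, are free. *)
Lemma overlap_sum_meet e s :
  overlap_sum (crosses e) s + minn 2 (count (fun A => e :&: A != set0) s)
    <= count (fun A => e :&: A != set0) s.
Proof.
elim: s => [//|A s IHs] /=.
have [cr|_] := boolP (crosses e _); last first.
  by case: (_ != _) => /=; lia.
have /andP[/meetP[x xe /setIP[+ xA]] _] := cr; rewrite inE => x2.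
have -> : e :&: A != set0 by apply/meetP; exists x.
have : count (fun B => x \in B) s <= count (fun B => e :&: B != set0) s.
  by apply: sub_count => B xB; apply/meetP; exists x.
by lia.
Qed.

Lemma bigcup_seqP (I : eqType) (r : seq I) (F : I -> {set V}) x :
  reflect (exists2 i, i \in r & x \in F i) (x \in \bigcup_(i <- r) F i).
Proof.
elim: r => [|i r IHr].
  by rewrite big_nil inE; right=> -[].
rewrite big_cons; apply: (iffP setUP) => [[xi|/IHr[j jr xj]]|[j]].
- by exists i => //; rewrite mem_head.
- by exists j => //; rewrite inE jr orbT.
- rewrite inE => /predU1P[->|jr] xj; [by left | right].
  by apply/IHr; exists j.
Qed.

(** * Cut values against partition costs *)

Lemma dcut_first_le_pcost E P :
  is_partition P -> dcut E (nth set0 P 0) <= pcost E P.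
Proof.
case: P => [|A P] [_ _ cov] /=.
  by rewrite dcutE big1 // => e _; rewrite /crosses setI0 eqxx.
apply: sub_count => e /andP[eA /meetP[x xe]]; rewrite inE => xA /=.
rewrite eA ltnS -has_count.
have : x \in \bigcup_(B <- A :: P) B by rewrite cov inE.
rewrite big_cons inE (negPf xA) /= => /bigcup_seqP[B BP xB].
by apply/hasP; exists B => //; apply/meetP; exists x.
Qed.

(* The cut [X] absorbs parts of the other classes; the transversal condition on
   [X] keeps them nonempty. *)
Lemma maximal_min_kpartition_cut E k P X :
  is_maximal_min_kpartition E k P -> 0 < k ->
  nth set0 P 0 \proper X ->
  (forall j, 1 <= j < k -> nth set0 P j :\: X != set0) ->
  dcut E (nth set0 P 0) < dcut E X.
Proof.
move=> [minP maxP] k0 prX trX; rewrite ltnNge; apply/negP => leX.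
have [[szP partP] optP] := minP.
case: P => [|A P] in minP maxP prX trX leX szP partP optP *.
  by rewrite -szP in k0.
rewrite /= in prX leX szP; have sAX := proper_sub prX.
have crossA e : crosses e A <= splits e (A :: P).
  have := @dcut_first_le_pcost [:: e] _ partP.
  by rewrite dcutE pcostE !big_seq1.
have [ne dis cov] := partP.
pose Q := X :: [seq B :\: X | B <- P].
have kQ : is_kpartition k Q.
  split; first by rewrite /= size_map.
  split.
  - apply/andP; split.
      by have /properP[_ [x xX _]] := prX; apply/set0Pn; exists x.
    apply/allP => _ /mapP[B /(nthP set0)[j jP <-] ->].
    by apply: (trX j.+1); rewrite -szP /= ltnS.
  - move=> [|i] [|j] //= ij; rewrite ltnS size_map => jP.
      rewrite (nth_map set0) // -setI_eq0 setIDA setDIl setDv set0I //.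
    have iP : i < size P by apply: ltn_trans jP.
    rewrite !(nth_map set0) // disjoint_sym.
    apply: disjointWl (subsetDl _ _) _; rewrite disjoint_sym.
    by apply: disjointWl (subsetDl _ _) _; apply: (dis i.+1 j.+1).
  - apply/setP=> x; rewrite [RHS]inE; have: x \in [set: V] by rewrite inE.
    rewrite -cov big_cons !big_cons big_map => /setUP xAP.
    apply/setUP; have [xX|xX] := boolP (x \in X); first by left.
    case: xAP => [/(subsetP sAX)|]; first by rewrite (negPf xX).
    move=> /bigcup_seqP[B BP xB]; right; apply/bigcup_seqP.
    by exists B => //; rewrite inE xX.
(* If [e] misses [X], it does not cross [A], and removing [X] from the parts creates no split; if it
   crosses [X], that crossing pays for a split of [Q]; if it lies in [X], [Q] does not split it. *)
have costQ : pcost E Q + dcut E A <= pcost E (A :: P) + dcut E X.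
  rewrite !pcostE !dcutE -!big_split /=; apply: leq_sum => e _.
  have := crossA e; have [eX|eX] := boolP (e :&: X != set0); last first.
    have -> : crosses e A = false.
      by apply: contraNF eX => /andP[eA _]; apply: meetS eA.
    suff : splits e Q -> splits e (A :: P).
      by case: (splits e Q) => [/(_ isT)->|] //=; lia.
    rewrite /splits /= (negPf eX) add0n count_map => /leq_trans; apply.
    apply: leq_trans (leq_addl _ _); apply: sub_count => B /=.
    exact: meetS (subsetDl _ _).
  have [eXc|eXc] := boolP (e :&: ~: X != set0).
    have -> : crosses e X by rewrite /crosses eX.
    by case: (splits e Q); lia.
  suff -> : splits e Q = false by lia.
  rewrite /splits /= count_map eX ltnNge.
  suff /eqP -> : count (preim (fun B => B :\: X) (fun B => e :&: B != set0)) P == 0.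
    by [].
  rewrite -leqn0 leqNgt -has_count; apply/hasPn => B _ /=.
  by apply: contra eXc; apply: meetS; rewrite setDE subsetIr.
apply: maxP; exists Q; split=> //; split=> // Q' kQ'.
by apply: leq_trans (optP _ kQ'); lia.
Qed.

(** * Partitions made of private parts *)

Section PrivateParts.
Variables (A : V -> {set V}) (r : seq V).
Hypothesis uniq_r : uniq r.

Definition private u : {set V} := A u :\: overlap (map A r).

Definition private_partition (I : seq V) : seq {set V} :=
  ~: (\bigcup_(u <- I) private u) :: map private I.

Lemma private_inj u v x :
  u \in r -> v \in r -> x \in private u -> x \in A v -> u = v.
Proof.
move=> ur vr /setDP[xu]; rewrite inE count_map => x1 xv.
by apply/eqP; apply: contraNT x1 => uv; apply: (count_gt1 uv).
Qed.

Lemma private_partitionP k (I : seq V) :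
  0 < k -> size I = k.-1 -> uniq I -> {subset I <= r} ->
  (forall u, u \in I -> private u != set0) ->
  ~: (\bigcup_(u <- I) private u) != set0 ->
  is_kpartition k (private_partition I).
Proof.
move=> k0 szI uI sI neI ne0; split; first by rewrite /= size_map szI prednK.
split.
- by rewrite /= ne0; apply/allP=> _ /mapP[u /neI neu ->].
- move=> [|i] [|j] //= ij; rewrite ltnS size_map => jI.
    rewrite disjoint_sym disjoints_subset setCK; apply/subsetP=> x.
    move=> xj; apply/bigcup_seqP.
    have u0 : V by case: (I) jI.
    exists (nth u0 I j); first exact: mem_nth.
    by rewrite -(nth_map u0 set0).
  have u0 : V by case: (I) jI.
  have iI : i < size I by apply: ltn_trans jI.
  rewrite !(nth_map u0) //.
  apply/pred0P=> x /=; apply/negP=> /andP[xi /setDP[xj _]].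
  have /eqP := private_inj (sI _ (mem_nth u0 iI)) (sI _ (mem_nth u0 jI)) xi xj.
  by rewrite nth_uniq // => /eqP ij'; rewrite ij' ltnn in ij.
- by rewrite /private_partition big_cons big_map setUC setUCr.
Qed.

(** Only one part is the remainder, so a split hyperedge meets a private part; if contained in it,
    the hyperedge would meet no other part. *)
Lemma splits_private_partition e (I : seq V) :
  uniq I -> {subset I <= r} -> splits e (private_partition I) ->
  exists2 u, u \in I & crosses e (private u).
Proof.
move=> uI sI; rewrite /splits /= count_map => sp.
have [u uI' eu] : exists2 u, u \in I & e :&: private u != set0.
  by apply/hasP; rewrite has_count; case: (_ != _) sp => // /ltnW.
exists u => //; rewrite /crosses eu /=; apply: contraLR sp => eCu.
have -> /= : (e :&: ~: (\bigcup_(v <- I) private v) != set0) = false.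
  apply: contraNF eCu; apply: meetS; rewrite setCS; apply/subsetP=> x xu.
  by apply/bigcup_seqP; exists u.
rewrite add0n -leqNgt; apply: (count_le1 (u := u)) => // v vI /=.
move=> /meetP[x xe /setDP[xv _]].
have xu : x \in private u.
  by apply: contraNT eCu => xu; apply/meetP; exists x => //; rewrite in_setC.
exact/esym/(private_inj (sI _ uI') (sI _ vI) xu xv).
Qed.

(** If [e] meets two private parts, it crosses every [A w] that it meets, and [overlap_sum_meet]
    leaves 2 for the two splits. Otherwise disjointness of [I] and [J] allows at most one split,
    paid for by the first two terms of [overlap_sum_crosses]. *)
Lemma splits_private_partitions e (I J : seq V) :
  uniq I -> uniq J -> {subset I <= r} -> {subset J <= r} ->
  (forall u, u \in I -> u \notin J) ->
  splits e (private_partition I) + splits e (private_partition J)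
    + overlap_sum (crosses e) (map A r) <= \sum_(u <- r) crosses e (A u).
Proof.
move=> uI uJ sI sJ IJ.
have [/existsP[u /existsP[v /and5P[uv ur vr eu ev]]]|no2] := boolP
  [exists u, exists v, [&& u != v, u \in r, v \in r, e :&: private u != set0
                         & e :&: private v != set0]].
  have := overlap_sum_meet e (map A r); rewrite count_map.
  set c := count _ r.
  (* One of the two private parts met has an index other than [w], so it supplies a vertex of [e]
     outside [A w]. *)
  have crE w : w \in r -> crosses e (A w) = (e :&: A w != set0).
    move=> wr; rewrite /crosses andb_idr // => _.
    have [z [zw zr /meetP[x xe xz]]] :
      exists z, [/\ z != w, z \in r & e :&: private z != set0].
      by have [uw|uw] := eqVneq u w; [exists v; rewrite -uw eq_sym | exists u].
    apply/meetP; exists x => //; rewrite inE; apply: contra zw => xw.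
    by rewrite (private_inj zr wr xz xw).
  have -> : \sum_(w <- r) crosses e (A w) = c.
    rewrite /c -sumn_count sumnE big_map big_seq [RHS]big_seq.
    by apply: eq_bigr => w /crE ->.
  have : 1 < c.
    by apply: (count_gt1 uv) => //=; [apply: meetS eu | apply: meetS ev];
      apply: subsetDl.
  by case: (splits _ _); case: (splits _ _); lia.
have uniq2 u v : u \in r -> v \in r -> e :&: private u != set0 ->
    e :&: private v != set0 -> u = v.
  move=> ur vr eu ev; apply/eqP; apply: contraNT no2 => uv.
  by apply/existsP; exists u; apply/existsP; exists v; apply/and5P.
have := overlap_sum_crosses e (map A r); rewrite big_map.
(* Here [y] is covered exactly once and [x] lies outside [private u]. By [uniq2], [x] is in no other
   private part, so it is covered at least twice or not at all. *)
have ov K : {subset K <= r} -> uniq K -> splits e (private_partition K) ->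
    0 < crosses e (overlap (map A r)) + crosses e (covered (map A r)).
  move=> sK uK /(splits_private_partition uK sK)[u uK' /andP[eu /meetP[x xe]]].
  rewrite inE => xu; have /meetP[y ye yu] := eu; have ur := sK _ uK'.
  have /setDP[yA yO] := yu.
  have yC : y \in covered (map A r).
    by rewrite inE has_map; apply/hasP; exists u.
  have [xO|xO] := boolP (x \in overlap (map A r)).
    have -> // : crosses e (overlap (map A r)).
    apply/andP; split; first by apply/meetP; exists x.
    by apply/meetP; exists y => //; rewrite inE.
  have -> // : crosses e (covered (map A r)); last by rewrite addn1.
  apply/andP; split; first by apply/meetP; exists y.
  apply/meetP; exists x => //; rewrite inE.
  rewrite inE has_map; apply/hasPn => v vr /=; apply/negP => xv.
  have xPv : x \in private v by rewrite inE xO.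
  have uv : u = v by apply: uniq2 => //; apply/meetP; exists x.
  by rewrite uv xPv in xu.
have IJn : ~~ (splits e (private_partition I) && splits e (private_partition J)).
  apply/negP => /andP[/(splits_private_partition uI sI)[u uI' /andP[eu _]]].
  move=> /(splits_private_partition uJ sJ)[v vJ' /andP[ev _]].
  have uv : u = v by apply: uniq2 => //; [apply: sI | apply: sJ].
  by have := IJ _ uI'; rewrite uv vJ'.
move: IJn (ov _ sI uI) (ov _ sJ uJ).
by case: (splits _ _); case: (splits _ _) => //= _;
  [move=> /(_ isT) + _ | move=> _ /(_ isT) |]; lia.
Qed.

Lemma pcost_private_partitions E (I J : seq V) :
  uniq I -> uniq J -> {subset I <= r} -> {subset J <= r} ->
  (forall u, u \in I -> u \notin J) ->
  pcost E (private_partition I) + pcost E (private_partition J)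
    + overlap_sum (dcut E) (map A r) <= \sum_(u <- r) dcut E (A u).
Proof.
move=> uI uJ sI sJ IJ.
rewrite !pcostE overlap_sum_dcut -!big_split /=.
under [leqRHS]eq_bigr do rewrite dcutE.
by rewrite exchange_big /=; apply: leq_sum => e _; apply: splits_private_partitions.
Qed.

End PrivateParts.

(** * From cheap cuts to a cheap partition *)

(** Once the tail has two entries, its overlap contains [R], while a point of [S] belongs to at most
    one entry; so the hypothesis on [D] applies to all but two summands. *)
Lemma overlap_sum_ge (f : {set V} -> nat) (A : V -> {set V}) R S D (r : seq V) :
  uniq r -> {subset r <= S} ->
  (forall u, u \in S -> R \subset A u) ->
  (forall u v, u \in S -> v \in S -> v \in A u -> v = u) ->
  (forall X, R \subset X -> [disjoint X & S] -> D <= f X) ->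
  (size r - 2) * D <= overlap_sum f (map A r).
Proof.
move=> + + RA AS fX; elim: r => [//|u r IHr] /= /andP[ur uniq_r] sub.
have sub_r : {subset r <= S} by move=> v vr; apply: sub; rewrite inE vr orbT.
have {}IHr := IHr uniq_r sub_r.
have [r2|r2] := ltnP 1 (size r); last first.
  by have -> : (size r).+1 - 2 = 0 by lia.
have -> : (size r).+1 - 2 = (size r - 2).+1 by lia.
rewrite mulSn leq_add //; apply: fX.
  rewrite subsetI RA ?sub ?mem_head // andbT; apply/subsetP=> x xR.
  rewrite inE count_map (eq_in_count (a2 := predT)) ?count_predT // => v vr /=.
  by rewrite (subsetP (RA _ (sub_r _ vr))).
apply/pred0P=> v /=; apply/negP=> /andP[/setIP[]]; rewrite inE count_map => v2 _ vS.
move: v2; apply/negP; rewrite -leqNgt.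
apply: (count_le1 (u := v)) => // w wr /= vw.
exact/esym/(AS w v (sub_r _ wr) vS vw).
Qed.

Lemma cheap_kpartition E k R S (A : V -> {set V}) D :
  1 < k -> 2 * k - 2 <= #|S| -> R != set0 ->
  (forall u, u \in S -> R \subset A u) ->
  (forall u, u \in S -> u \in A u) ->
  (forall u v, u \in S -> v \in S -> v \in A u -> v = u) ->
  (forall X, R \subset X -> [disjoint X & S] -> D <= dcut E X) ->
  (forall u, u \in S -> dcut E (A u) < D) ->
  exists2 Q, is_kpartition k Q & pcost E Q < D.
Proof.
move=> k1 kS R0 RA uA AS DX AD.
have szS : size (enum S) = #|S| by rewrite -cardE.
pose I := take k.-1 (enum S); pose J := take k.-1 (drop k.-1 (enum S)).
have uS : uniq (enum S) := enum_uniq _.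
have ovS u : u \in S -> u \notin overlap (map A (enum S)).
  move=> uS'; rewrite inE count_map -leqNgt.
  apply: (count_le1 (u := u)) => // w.
  by rewrite mem_enum => wS /= uw; apply/esym/AS.
(* Since [#|S|] is at least 2, [R] is covered twice; it therefore lies in the remainder, which is
   thus nonempty. *)
have Rov : R \subset overlap (map A (enum S)).
  apply/subsetP=> x xR; rewrite inE count_map (eq_in_count (a2 := predT)).
    by rewrite count_predT szS; lia.
  by move=> v; rewrite mem_enum => vS /=; rewrite (subsetP (RA _ vS)).
have kp K : uniq K -> {subset K <= enum S} -> size K = k.-1 ->
    is_kpartition k (private_partition A (enum S) K).
  move=> uK sK szK; apply: private_partitionP => //; first by lia.
    move=> u /sK; rewrite mem_enum => uS'.
    by apply/set0Pn; exists u; rewrite inE ovS ?uA.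
  have /set0Pn[x xR] := R0; apply/set0Pn; exists x; rewrite inE.
  by apply/negP=> /bigcup_seqP[u _ /setDP[_]]; rewrite (subsetP Rov).
have uI : uniq I by rewrite take_uniq.
have uJ : uniq J by rewrite take_uniq // drop_uniq.
have sI : {subset I <= enum S} by move=> u /mem_take.
have sJ : {subset J <= enum S} by move=> u /mem_take /mem_drop.
have szI : size I = k.-1 by rewrite size_takel // szS; lia.
have szJ : size J = k.-1 by rewrite size_takel // size_drop szS; lia.
have IJ u : u \in I -> u \notin J.
  move=> uI'; apply/negP => /mem_take uJ'.
  move: uS; rewrite -(cat_take_drop k.-1 (enum S)) cat_uniq => /and3P[_ /hasPn].
  by move=> /(_ _ uJ'); rewrite uI'.
have := @pcost_private_partitions A _ uS E _ _ uI uJ sI sJ IJ.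
have : (size (enum S) - 2) * D <= overlap_sum (dcut E) (map A (enum S)).
  by apply: (overlap_sum_ge (R := R) (S := S)) => // u; rewrite mem_enum.
have : \sum_(u <- enum S) (dcut E (A u)).+1 <= \sum_(u <- enum S) D.
  by rewrite big_seq [leqRHS]big_seq; apply: leq_sum => u; rewrite mem_enum => /AD.
under eq_bigr do rewrite -addn1.
rewrite big_split /= !big_const_seq !count_predT !iter_addn_0 szS => h1 h2 h3.
have [lt|ge] := ltnP (pcost E (private_partition A (enum S) I)) D.
  by exists (private_partition A (enum S) I) => //; apply: kp.
exists (private_partition A (enum S) J); first exact: kp.
(* The two costs sum to at most [2 * D - #|S|], so they cannot both reach [D]. *)
have : #|S| * D = (#|S| - 2) * D + 2 * D by rewrite -mulnDl subnK //; lia.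
by lia.
Qed.

(** * Certificates and shrinking of the source set *)

(** A boolean form of source maximality, so that its failure yields an explicit cut [X]. *)
Definition source_certificate E U T S : bool :=
  [forall X : {set V}, (S \subset X) && (X \subset ~: T) ==>
    (dcut E U <= dcut E X) && ((U \proper X) ==> (dcut E U < dcut E X))].

Lemma source_certificateP E U T S :
  S \subset U -> U \subset ~: T -> source_certificate E U T S ->
  is_source_maximal_min_terminal_cut E S T U.
Proof.
move=> SU UT /forallP cert; split.
  split=> // X [SX XT]; have := cert X; rewrite SX XT /=.
  by case/andP.
move=> [X [[[SX XT] minX] UX]]; have := cert X; rewrite SX XT UX /=.
by rewrite ltnNge minX ?andbF.
Qed.

Lemma source_certificate_shrink E k P T S :
  1 < k -> is_min_kpartition E k P -> nth set0 P 0 \subset ~: T ->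
  nth set0 P 0 != setT ->
  S \subset nth set0 P 0 -> source_certificate E (nth set0 P 0) T S ->
  2 * k - 2 < #|S| ->
  exists2 u, u \in S & source_certificate E (nth set0 P 0) T (S :\ u).
Proof.
move: (nth set0 P 0) (@dcut_first_le_pcost E P) => U leU k1 [[szP partP] optP].
move=> UT UnT SU /forallP cert cardS; apply/exists_inP; apply/contraT => stuck.
have minU X : S \subset X -> X \subset ~: T -> dcut E U <= dcut E X.
  by move=> SX XT; have := cert X; rewrite SX XT => /andP[].
(* Membership in [S] sits under the existential so that [fin_all_exists] can choose a set for every
   vertex; outside [S] the choice is a dummy. *)
have cut u : exists X : {set V}, u \in S ->
    [/\ S :\ u \subset X, X \subset U, u \notin X & dcut E X < dcut E U].
  have [uS|_] := boolP (u \in S); last by exists set0.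
  have /exists_inPn/(_ u uS)/forallPn[X] := stuck.
  rewrite negb_imply => /andP[/andP[SX XT] bad].
  (* The other way to fail, a proper superset of [U] of no larger cut value, is excluded by the
     certificate for [S]. *)
  have ltX : dcut E X < dcut E U.
    rewrite ltnNge; apply: contra bad => leX; rewrite leX /=.
    apply/implyP => UX; have := cert X.
    by rewrite XT (subset_trans SU (proper_sub UX)) UX leX.
  have uX : u \notin X.
    apply: contraL ltX => uX; rewrite -leqNgt; apply: minU => //.
    by rewrite -(setD1K uS) subUset sub1set uX.
  (* As [X :|: U] is still an [(S,T)]-terminal cut, submodularity keeps the intersection cheaper
     than [U]. *)
  exists (X :&: U) => _; split.
  - by rewrite subsetI SX (subset_trans (subD1set _ _)).
  - exact: subsetIr.
  - by rewrite inE (negPf uX).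
  - have := dcut_submod E X U; have : dcut E U <= dcut E (X :|: U).
      by apply: minU; [apply: subset_trans SU (subsetUr _ _) | rewrite subUset XT].
    by lia.
have [F FP] := fin_all_exists cut.
have [|||||||Q kQ] := @cheap_kpartition E k (~: U) S (fun u => ~: F u) (dcut E U) k1.
- exact: ltnW.
- by apply: contra UnT => /eqP U0; rewrite -(setCK U) U0 setC0.
- by move=> u /FP[_ FU _ _]; rewrite setCS.
- by move=> u /FP[_ _ uF _]; rewrite inE.
- move=> u v /FP[SF _ _ _] vS; rewrite inE => vF.
  apply/eqP; apply: contraNT vF => vu.
  by apply: (subsetP SF); rewrite !inE vu.
- move=> X UX XS; rewrite -(dcutC E X); apply: minU.
    by rewrite -disjoints_subset disjoint_sym.
  by apply: subset_trans UT; rewrite -(setCK U) setCS.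
- by move=> u /FP[_ _ _ lt]; rewrite dcutC.
(* The cost of [Q] is below [dcut E U], hence below the minimum cost, that of [P]. *)
- by rewrite ltnNge (leq_trans (leU partP) (optP _ kQ)).
Qed.

End Uncrossing.

Theorem theorem1p2 (V : finType) (E : seq {set V}) (k : nat)
  (P : seq {set V}) :
  2 <= k ->
  is_maximal_min_kpartition E k P ->
  2 * k - 2 <= #|nth set0 P 0| ->
  forall T : {set V},
    T \subset ~: nth set0 P 0 ->
    (forall j, 1 <= j < k -> T :&: nth set0 P j != set0) ->
    exists S : {set V},
      [/\ S \subset nth set0 P 0, #|S| = 2 * k - 2 &
          is_source_maximal_min_terminal_cut E S T (nth set0 P 0)].
Proof.
move=> k2 maxP cardV1 T TV1 trT.
have minP := maxP.1.
set U := nth set0 P 0 in cardV1 TV1 *.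
have UT : U \subset ~: T by rewrite -(setCK U) setCS.
have UnT : U != setT.
  have /set0Pn[x /setIP[xT _]] := trT 1 k2.
  by apply: contraTneq (subsetP TV1 _ xT) => ->; rewrite !inE.
have certU : source_certificate E U T U.
  (* A point of [T] in each later part survives the removal of [X], which avoids [T]. *)
  have ltX (X : {set V}) : U \proper X -> X \subset ~: T -> dcut E U < dcut E X.
    move=> UX XT; apply: (maximal_min_kpartition_cut maxP) => //; first exact: ltnW.
    move=> j /trT /set0Pn[x /setIP[xT xj]]; apply/set0Pn; exists x.
    rewrite inE xj andbT; apply: contraL xT => /(subsetP XT).
    by rewrite inE.
  apply/forallP => X; apply/implyP => /andP[UX XT].
  rewrite andbC; apply/andP; split; first by apply/implyP => /ltX; apply.
  have [->//|UnX] := eqVneq U X.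
  by apply/ltnW/ltX; rewrite // properEneq UnX.
(* Induction on the surplus [n] of [S] over the target size [2 * k - 2]. *)
suff descent n (S : {set V}) : #|S| = 2 * k - 2 + n -> S \subset U ->
    source_certificate E U T S ->
    exists S' : {set V}, [/\ S' \subset U, #|S'| = 2 * k - 2 &
                             source_certificate E U T S'].
  have [|S [SU cS certS]] := descent (#|U| - (2 * k - 2)) U _ (subxx U) certU.
    by rewrite subnKC.
  by exists S; split=> //; apply: source_certificateP.
elim: n S => [|n IHn] S cS SU certS; first by exists S; rewrite -[RHS]addn0.
have [|u uS certu] := source_certificate_shrink k2 minP UT UnT SU certS.
  by rewrite cS; lia.
apply: (IHn (S :\ u)) => //; last by apply: subset_trans SU; apply: subD1set.
by have := cardsD1 u S; rewrite uS cS; lia.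
Qed.
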